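(* Let $\varkappa\geq 2$ be an integer. Let $\{a_n\}_{n=0}^\infty$ be a Stieltjes moment sequence with a representing measure $\mu$, and suppose that $\{\sqrt[\varkappa]{a_n}\}_{n=0}^\infty$ is a Stieltjes moment sequence with a representing measure $\nu$. Suppose that $\mu((\vartheta_1,\vartheta_2))=0$ for some $\vartheta_1,\vartheta_2\in\mathbb{R}$ such that $0<\vartheta_1<\vartheta_2<\vartheta_3:=\sup\operatorname{supp}\mu<\infty$. Set $\alpha=\frac{\vartheta_1}{\vartheta_3}\sqrt[\varkappa]{\vartheta_3}$ and $\beta=\sqrt[\varkappa]{\vartheta_2}$, and let $\iota_{\mathrm{s}}=\iota_{\mathrm{s}}(\vartheta_1,\vartheta_2,\vartheta_3)$ and $\iota_{\mathrm{s}}^*=\iota_{\mathrm{s}}^*(\vartheta_1,\vartheta_2,\vartheta_3)$. If any one of the following conditions is satisfied, then $\nu((\alpha,\beta))=0$: (i) $\varkappa\geq\iota_{\mathrm{s}}^*$ and $\beta\in\operatorname{supp}\nu$; (ii) $\iota_{\mathrm{s}}\geq\iota_{\mathrm{s}}^*$ and $\beta\in\operatorname{supp}\nu$; (iii) $\iota_{\mathrm{s}}\geq 3$ and $\beta\in\operatorname{supp}\nu$; (iv) $\iota_{\mathrm{s}}\geq 4$; (v) $\iota_{\mathrm{s}}^*=1$.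
   Context: $\mathbb{R}_+=[0,\infty)$. A sequence $\{a_n\}_{n=0}^\infty\subseteq\mathbb{R}_+$ is a Stieltjes moment sequence if there is a positive Borel measure $\mu$ on $\mathbb{R}_+$ with $a_n=\int_{\mathbb{R}_+}x^n\,d\mu(x)$ for all integers $n\geq 0$ (with $x^0=1$); such $\mu$ is called a representing measure of $\{a_n\}_{n=0}^\infty$. $\operatorname{supp}$ denotes the closed support of a measure. For real numbers $0<\vartheta_1<\vartheta_2<\vartheta_3$, $$\iota_{\mathrm{s}}(\vartheta_1,\vartheta_2,\vartheta_3)=1+\left\lfloor\frac{\log(\vartheta_3/\vartheta_1)}{\log(\vartheta_3/\vartheta_2)}\right\rfloor,\qquad \iota_{\mathrm{s}}^*(\vartheta_1,\vartheta_2,\vartheta_3)=1+\left\lfloor\frac{\log(\vartheta_3/\vartheta_2)}{\log(\vartheta_2/\vartheta_1)}\right\rfloor.$$ *)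

(* Defs.v *)
From HB Require Import structures.
From mathcomp Require Import all_boot all_order all_algebra.
From mathcomp Require Import all_classical all_reals all_analysis.

Set Implicit Arguments.
Unset Strict Implicit.
Unset Printing Implicit Defensive.

Import Order.TTheory GRing.Theory Num.Theory.
Import numFieldNormedType.Exports.

Local Open Scope classical_set_scope.
Local Open Scope ring_scope.

(* A Borel measure on [0, +oo[ is encoded as a Borel measure on R that
   vanishes on ]-oo, 0[ (its extension by zero); this changes neither the
   integrals over [0, +oo[ nor the closed support.  The 0-th moment uses
   x ^+ 0 = 1, also at x = 0, and finiteness of the moments is implied by
   their being equal to real numbers. *)
Definition representing_measure (R : realType)
    (mu : {measure set (measurableTypeR R) -> \bar R}) (a : nat -> R) : Prop :=
  mu `]-oo, 0%R[%classic = 0%E /\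
  forall n : nat, (a n)%:E = (\int[mu]_(x in `[0%R, +oo[) (x ^+ n)%:E)%E.

Definition stieltjes_moment_seq (R : realType) (a : nat -> R) : Prop :=
  (forall n, 0 <= a n) /\
  exists mu : {measure set (measurableTypeR R) -> \bar R},
    representing_measure mu a.

Definition msupport (R : realType)
    (mu : {measure set (measurableTypeR R) -> \bar R}) : set R :=
  [set x : R | forall U : set R, open U -> U x -> (0 < mu U)%E].

(* The k-th root of a nonnegative number; since 0 `^ r = 0 for r != 0, the
   root of 0 is 0 when 0 < k. *)
Definition kroot (R : realType) (k : nat) (x : R) : R := x `^ (k%:R^-1).

Definition iota_s (R : realType) (t1 t2 t3 : R) : int :=
  1 + Num.floor (ln (t3 / t1) / ln (t3 / t2)).

Definition iota_s_star (R : realType) (t1 t2 t3 : R) : int :=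
  1 + Num.floor (ln (t3 / t2) / ln (t2 / t1)).

(* Main.v *)
Require Import Defs.
From HB Require Import structures.
From mathcomp Require Import all_boot all_order all_algebra.
From mathcomp Require Import all_classical all_reals all_analysis.
From mathcomp Require Import measurable_realfun.
From mathcomp Require Import ring lra zify.

Import Order.TTheory GRing.Theory Num.Theory.
Import numFieldNormedType.Exports.

Local Open Scope classical_set_scope.
Local Open Scope ring_scope.

(** Write b n for the k-th root of a n, so that b is the moment sequence of nu
    and its k-th power is the moment sequence of mu.  Morally mu is the image
    of the k-fold product measure of nu under multiplication, hence every
    product of k points of the support of nu lies in the support of mu and
    must avoid the gap ]theta1, theta2[.

    The proof carries this out on moments, through the linear functional L
    on polynomials sending 'X^n to the n-th term of a sequence. Call p
    visible to L when L q is bounded below by a positive constant, uniformly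
    over the polynomials q that are nonnegative on [0, +oo[ and at least 1
    near p ([functional_support]). Integrating over one more variable shows
    that if p is visible to the functional of b' and x is in the support of
    nu then x * p is visible to the functional of b * b'
    ([functional_supportM]); hence products of k support points of nu are
    visible to the functional of a. On the other hand this functional is
    integration against mu, and a point of a gap of a compactly supported
    measure is never visible: even powers of a quadratic that is at least 1
    near p and has values in [0, rho] off the gap, rho < 1, have integrals
    tending to 0 ([functional_support_avoids_gap]).

    Growth of moments shows that the maximum of the support of nu is the k-th
    root g of theta3 ([msupport_root_of_top]).  Now let x be a support point
    with alpha < x < beta.  Two chains of products of k support points start
    at x * g ^ (k - 1) > theta1 and end below theta2:
    - x ^ i * g ^ (k - i) for i >= 1, ending at x ^ k;
    - x * beta ^ i * g ^ (k - 1 - i), ending at x * beta ^ (k - 1), which is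
      available when beta is in the support.
    The first term below theta2 lies in the gap as soon as one step of the
    chain cannot jump over it.  For the first chain this holds when
    iota_s^* <= 1, for the second one when iota_s^* <= k.  Finally iota_s >= 4
    forces iota_s^* <= 1, and either of iota_s >= 3, iota_s >= iota_s^* forces
    iota_s^* <= 2 <= k, so the five conditions reduce to these two. *)

(** * Supports of Borel measures on the line *)

Lemma msupportN_ball {R : realType}
    {nu : {measure set (measurableTypeR R) -> \bar R}} {x : R} :
  ~ msupport nu x -> exists2 e : R, 0 < e & nu `]x - e, x + e[%classic = 0%E.
Proof.
move=> /existsNP[V /not_implyP[oV /not_implyP[Vx V0]]].
have nuV : nu V = 0%E by apply/eqP; move/negP: V0; rewrite measure_gt0 negbK.
have [e /= e0 xeV] : nbhs_ball x V.
  by apply/nbhs_ballP; apply: open_nbhs_nbhs; split.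
exists e => //; apply/eqP; rewrite -measure_le0 -nuV; apply: le_measure.
- by rewrite inE; exact: measurable_itv.
- by rewrite inE; exact: open_measurable.
- by rewrite -ball_itv.
Qed.

(** The line is second countable: the null intervals with rational endpoints
    are countably many and cover the complement of the support. *)
Lemma measure0_of_disjoint_msupport {R : realType}
    {nu : {measure set (measurableTypeR R) -> \bar R}} {U : set R} :
  measurable U -> (forall x, U x -> ~ msupport nu x) -> nu U = 0%E.
Proof.
move=> mU U0.
pose I (pq : rat * rat) : set (measurableTypeR R) :=
  `]ratr pq.1, ratr pq.2[%classic.
pose F n : set (measurableTypeR R) := if unpickle n is Some pq then
  if nu (I pq) == 0%E then I pq else set0 else set0.
apply: measure_negligible => //.
suff : nu.-negligible (\bigcup_n F n).
  apply: negligibleS.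
  move=> x /U0 /msupportN_ball[e e0 nue].
  have [p] : exists q : rat, ratr q \in `]x - e, x[.
    by apply: rat_in_itvoo; rewrite gtrDl oppr_lt0.
  rewrite in_itv /= => /andP[p1 p2].
  have [q] : exists q : rat, ratr q \in `]x, x + e[.
    by apply: rat_in_itvoo; rewrite ltrDl.
  rewrite in_itv /= => /andP[q1 q2].
  exists (pickle (p, q)); first exact: Logic.I.
  rewrite /F pickleK.
  suff -> : nu (I (p, q)) == 0%E by rewrite /I /= in_itv /= p2 q1.
  rewrite -measure_le0 -nue; apply: le_measure.
  - by rewrite inE; exact: measurable_itv.
  - by rewrite inE; exact: measurable_itv.
  - move=> y; rewrite /I /= !in_itv /= => /andP[py yq].
    by rewrite (lt_trans p1 py) (lt_trans yq q2).
apply: negligible_bigcup => n; rewrite /F.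
case: unpickle => [pq|]; last exact: negligible_set0.
case: eqP => [Ipq0|_]; last exact: negligible_set0.
by exists (I pq); split => //; exact: measurable_itv.
Qed.

(** * Moment functionals on polynomials *)

Definition moment_functional {R : realType} (b : nat -> R) (q : {poly R}) : R :=
  \sum_(i < size q) q`_i * b i.

Definition nonneg_on_Rplus {R : realType} (q : {poly R}) : Prop :=
  forall x, 0 <= x -> 0 <= q.[x].

(** Coefficients beyond the degree vanish, so the summation range may be any
    bound on the size; this lets polynomials with the same formal length be
    compared without computing their exact sizes. *)
Lemma moment_functional_wide {R : realType} (b : nat -> R) (q : {poly R}) {n} :
  (size q <= n)%N -> moment_functional b q = \sum_(i < n) q`_i * b i.
Proof.
move=> qn; rewrite /moment_functional (big_ord_widen n (fun i => q`_i * b i))//.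
rewrite big_mkcond; apply: eq_bigr => i _.
by case: ltnP => // qi; rewrite nth_default// mul0r.
Qed.

Lemma moment_functionalXn {R : realType} (b : nat -> R) n :
  moment_functional b 'X^n = b n.
Proof.
rewrite /moment_functional size_polyXn big_ord_recr /= coefXn eqxx mul1r.
rewrite big1 ?add0r// => i _; rewrite coefXn.
by rewrite (ltn_eqF (ltn_ord i)) mul0r.
Qed.

Section representing_measure.
Context {R : realType}.
Implicit Types (nu : {measure set (measurableTypeR R) -> \bar R}).
Implicit Types (b : nat -> R) (q : {poly R}).

Let mRplus : measurable (`[0, +oo[%classic : set (measurableTypeR R)).
Proof. exact: measurable_itv. Qed.

Lemma integrable_monomial {nu b} n : representing_measure nu b ->
  nu.-integrable `[0, +oo[%classic (fun x : R => (x ^+ n)%:E).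
Proof.
move=> [_ bE]; apply/integrableP; split.
  by apply/measurable_EFinP; exact: measurable_funX.
rewrite (_ : (\int[_]_(_ in _) _)%E = (b n)%:E) ?ltry// bE.
apply: eq_integral => x; rewrite inE /= in_itv /= andbT => x0.
by rewrite ger0_norm// exprn_ge0.
Qed.

Lemma integral_poly {nu b} q : representing_measure nu b ->
  (\int[nu]_(x in `[0%R, +oo[) (q.[x])%:E = (moment_functional b q)%:E)%E.
Proof.
move=> nub; have [_ bE] := nub.
have intX n := integrable_monomial n nub.
transitivity (\int[nu]_(x in `[0%R, +oo[)
    (\sum_(i < size q) (q`_i)%:E * (x ^+ i)%:E))%E.
  apply: eq_integral => x _; rewrite horner_coef -sumEFin.
  by under eq_bigr do rewrite EFinM.
rewrite integral_sum//; last by move=> i; apply: integrableZl.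
rewrite /moment_functional -sumEFin; apply: eq_bigr => i _.
by rewrite integralZl// -bE.
Qed.

(** Markov's inequality: this turns positive mass near a support point into
    a lower bound on the functional. *)
Lemma le_moment_functional {nu b q} {U : set (measurableTypeR R)} {c} :
  representing_measure nu b ->
  nonneg_on_Rplus q -> measurable U -> 0 <= c ->
  (forall x, 0 <= x -> U x -> c <= q.[x]) ->
  (c%:E * nu U <= (moment_functional b q)%:E)%E.
Proof.
move=> nub q0 mU c0 cq; have [nuN _] := nub.
have mUp : measurable (U `&` `[0, +oo[ : set (measurableTypeR R)).
  exact: measurableI.
have -> : nu U = nu (U `&` `[0, +oo[).
  have {1}-> : U = (U `&` `[0, +oo[) `|` (U `&` `]-oo, 0[).
    rewrite -setIUr; apply/esym/setIidl => x _ /=; rewrite !in_itv /= andbT.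
    by case: leP; [left|right].
  apply: measureU0 => //; first exact: measurableI.
  by apply: subset_measure0 nuN => //; exact: measurableI.
rewrite -(integral_poly q nub) -integral_cst//.
apply: (@le_trans _ _ (\int[nu]_(x in U `&` `[0%R, +oo[) (q.[x])%:E)%E).
  apply: ge0_le_integral => //.
  - by apply/measurable_EFinP; exact: measurable_poly.
  - by move=> x [Ux]; rewrite /= in_itv /= andbT lee_fin => x0; exact: cq.
apply: ge0_subset_integral => //.
- by apply/measurable_EFinP; exact: measurable_poly.
- by move=> x; rewrite /= in_itv /= andbT lee_fin => x0; exact: q0.
Qed.

Lemma moment_functional_le {nu b q} {N : set (measurableTypeR R)} {M} :
  representing_measure nu b ->
  nonneg_on_Rplus q -> measurable N -> nu N = 0%E -> 0 <= M ->
  (forall x, 0 <= x -> ~ N x -> q.[x] <= M) ->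
  moment_functional b q <= M * b 0.
Proof.
move=> nub q0 mN N0 M0 qM; have [_ bE] := nub.
rewrite -lee_fin -(integral_poly q nub).
rewrite (@ge0_negligible_integral _ (measurableTypeR R) _ _ _ N)//; last 2 first.
- by apply/measurable_EFinP; exact: measurable_poly.
- by move=> x; rewrite /= in_itv /= andbT lee_fin => x0; exact: q0.
have mD : measurable (`[0, +oo[%classic `\` N : set (measurableTypeR R)).
  exact: measurableD.
apply: (@le_trans _ _ (\int[nu]_(x in `[0%R, +oo[%classic `\` N) cst M%:E x)%E).
  apply: ge0_le_integral => //.
  - by move=> x []; rewrite /= in_itv /= andbT lee_fin => x0 _; exact: q0.
  - by apply/measurable_EFinP; exact: measurable_poly.
  - by move=> x []; rewrite /= in_itv /= andbT lee_fin => x0 Nx; exact: qM.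
rewrite integral_cst// EFinM lee_wpmul2l// bE.
under eq_integral do rewrite expr0.
rewrite integral_cst// mul1e; apply: le_measure; rewrite ?inE//.
Qed.

End representing_measure.

(** * Points visible to a moment functional *)

Definition positive_functional {R : realType} (b : nat -> R) : Prop :=
  forall q, nonneg_on_Rplus q -> 0 <= moment_functional b q.

(** By Markov's inequality, every support point of a measure with moment
    sequence b has this property (take for c the mass of a small ball); but
    the definition only refers to the sequence, so that it also applies to
    products of moment sequences before these are known to have a representing
    measure. *)
Definition functional_support {R : realType} (b : nat -> R) (p : R) : Prop :=
  forall d, 0 < d -> exists2 c, 0 < c &
  forall q, nonneg_on_Rplus q ->
    (forall x, 0 <= x -> `|x - p| < d -> 1 <= q.[x]) ->
    c <= moment_functional b q.

(** [dilate y q] is q (y * 'X), and [partial_moment b q] is the polynomial in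
    y obtained by applying the functional of b to it in the remaining
    variable: q (y * z) with z integrated out. *)
Definition dilate {R : realType} (y : R) (q : {poly R}) : {poly R} :=
  \poly_(i < size q) (q`_i * y ^+ i).

Lemma horner_dilate {R : realType} (y x : R) (q : {poly R}) :
  (dilate y q).[x] = q.[y * x].
Proof.
rewrite horner_poly horner_coef; apply: eq_bigr => i _.
by rewrite exprMn mulrA.
Qed.

Definition partial_moment {R : realType} (b : nat -> R) (q : {poly R}) :
  {poly R} := \poly_(i < size q) (q`_i * b i).

Lemma horner_partial_moment {R : realType} (b : nat -> R) (q : {poly R}) y :
  (partial_moment b q).[y] = moment_functional b (dilate y q).
Proof.
rewrite horner_poly (@moment_functional_wide _ _ _ (size q)) ?size_poly//.
by apply: eq_bigr => i _; rewrite coef_poly ltn_ord mulrAC.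
Qed.

(** Fubini for the product of two independent variables: the n-th moment of
    the product is the product of the n-th moments. *)
Lemma moment_functionalM {R : realType} (b b' : nat -> R) (q : {poly R}) :
  moment_functional (fun n => b n * b' n) q =
  moment_functional b (partial_moment b' q).
Proof.
rewrite [RHS](@moment_functional_wide _ _ _ (size q)) ?size_poly//.
by apply: eq_bigr => i _; rewrite coef_poly ltn_ord mulrA mulrAC.
Qed.

Lemma nonneg_dilate {R : realType} {y : R} {q : {poly R}} :
  0 <= y -> nonneg_on_Rplus q -> nonneg_on_Rplus (dilate y q).
Proof. by move=> y0 q0 x x0; rewrite horner_dilate q0// mulr_ge0. Qed.

Lemma nonneg_partial_moment {R : realType} {b : nat -> R} {q : {poly R}} :
  positive_functional b -> nonneg_on_Rplus q ->
  nonneg_on_Rplus (partial_moment b q).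
Proof.
by move=> b0 q0 y y0; rewrite horner_partial_moment b0//; exact: nonneg_dilate.
Qed.

Section product.
Context {R : realType}.
Implicit Types (nu : {measure set (measurableTypeR R) -> \bar R}).
Implicit Types (b : nat -> R) (q : {poly R}).

Lemma positive_functionalM {nu b b'} : representing_measure nu b ->
  positive_functional b' -> positive_functional (fun n => b n * b' n).
Proof.
move=> nub b'0 q q0; rewrite moment_functionalM.
have := @le_moment_functional _ _ _ _ set0 0 nub
  (nonneg_partial_moment b'0 q0) measurable0 (lexx _).
by rewrite measure0 mule0 lee_fin; exact.
Qed.

(** For y near x, the polynomial z |-> q (y * z) is at least 1 near p as soon
    as q is at least 1 near x * p; so the partial moment of q is bounded below
    on a ball around x, which has positive mass. *)
Lemma functional_supportM {nu b b' x p} : representing_measure nu b ->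
  positive_functional b' -> msupport nu x -> functional_support b' p ->
  functional_support (fun n => b n * b' n) (x * p).
Proof.
move=> nub b'0 Sx Sp d d0.
(* |y z - x p| <= |y - x| |p| + |y| |z - p| <= e (|p| + |x| + 1) < d *)
pose e := Num.min 1 (d / (`|x| + `|p| + 2)).
have D0 : 0 < `|x| + `|p| + 2 by rewrite ltr_wpDl// addr_ge0.
have e0 : 0 < e by rewrite lt_min ltr01 divr_gt0.
have e1 : e <= 1 by rewrite ge_min lexx.
have ed : e * (`|x| + `|p| + 2) <= d.
  by rewrite -ler_pdivlMr// ge_min lexx orbT.
have [c c0 cP] := Sp e e0.
have nu0 : (0 < nu (ball x e))%E.
  by apply: Sx; [exact: ball_open | exact: ballxx].
have nufin : nu (ball x e) \is a fin_num.
  rewrite ge0_fin_numE//; have [_ /(_ 0%N) b0E] := nub.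
  have := @le_moment_functional _ _ _ 'X^0 setT 1 nub.
  rewrite moment_functionalXn mul1e expr0 => /(_ _ measurableT ler01) nuT.
  apply: (@le_lt_trans _ _ (b 0)%:E); last exact: ltry.
  apply: (le_trans (le_measure nu _ _ (@subsetT _ (ball x e)))); rewrite ?inE//.
    exact: measurable_ball.
  by apply: nuT => y *; rewrite hornerE.
exists (c * fine (nu (ball x e))).
  by rewrite mulr_gt0// fine_gt0// nu0 -ge0_fin_numE.
move=> q q0 q1; rewrite moment_functionalM -lee_fin EFinM fineK//.
apply: le_moment_functional => //.
- exact: nonneg_partial_moment.
- exact: measurable_ball.
- exact: ltW.
move=> y y0; rewrite /ball /= distrC => yx; rewrite horner_partial_moment.
apply: cP; first exact: nonneg_dilate.
move=> z z0 zp; rewrite horner_dilate; apply: q1; first exact: mulr_ge0.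
have -> : y * z - x * p = (y - x) * p + y * (z - p) by ring.
apply: le_lt_trans (ler_normD _ _) _; rewrite !normrM.
apply: lt_le_trans ed.
have ylt : `|y| <= `|x| + 1.
  rewrite -[y](subrK x) (le_trans (ler_normD _ _))// addrC lerD2l.
  by rewrite (le_trans (ltW yx)).
apply: (@le_lt_trans _ _ (e * `|p| + (`|x| + 1) * e)); last first.
  by move: e0; nra.
by apply: lerD; [rewrite ler_wpM2r// ltW | rewrite ler_pM// ltW].
Qed.

Lemma moment_functionalX0 b q :
  moment_functional (fun n => b n ^+ 0) q = q.[1].
Proof.
by rewrite horner_coef; apply: eq_bigr => i _; rewrite expr0 expr1n.
Qed.

Lemma positive_functionalX {nu b} j : representing_measure nu b ->
  positive_functional (fun n => b n ^+ j).
Proof.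
move=> nub; elim: j => [|j IH].
  by move=> q q0; rewrite moment_functionalX0 q0.
have -> : (fun n => b n ^+ j.+1) = (fun n => b n * b n ^+ j).
  by apply/funext => n; rewrite exprS.
exact: positive_functionalM nub IH.
Qed.

Lemma functional_supportX {nu b x y i j} : representing_measure nu b ->
  msupport nu x -> msupport nu y ->
  functional_support (fun n => b n ^+ (i + j)) (x ^+ i * y ^+ j).
Proof.
move=> nub Sx Sy; elim: i => [|i IH]; last first.
  have -> : (fun n => b n ^+ (i.+1 + j)) = (fun n => b n * b n ^+ (i + j)).
    by apply/funext => n; rewrite -exprS.
  rewrite exprS -mulrA.
  exact: functional_supportM (positive_functionalX _ nub) Sx IH.
rewrite expr0 mul1r add0n; elim: j => [|j IH]; last first.
  have -> : (fun n => b n ^+ j.+1) = (fun n => b n * b n ^+ j).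
    by apply/funext => n; rewrite exprS.
  rewrite exprS.
  exact: functional_supportM (positive_functionalX _ nub) Sy IH.
move=> d d0; exists 1 => // q q0 q1; rewrite moment_functionalX0.
by rewrite q1// expr0 subrr normr0.
Qed.

(** The test polynomials are even powers of a downward parabola that is at least
    1 within distance d of p and has values in [0, rho], where rho < 1, at the
    points of [0, t3] off the gap, which are at distance at least 2 * d. *)
Lemma functional_support_avoids_gap
    {mu : {measure set (measurableTypeR R) -> \bar R}} {a} {t1 t2 t3 p : R} :
  representing_measure mu a -> 0 < t1 -> t2 < t3 ->
  mu `]t1, t2[%classic = 0%E -> mu `]t3, +oo[%classic = 0%E ->
  functional_support a p -> ~ t1 < p < t2.
Proof.
move=> mua t10 t23 mu12 mu3 Sp /andP[t1p pt2].
pose d := Num.min (p - t1) (t2 - p) / 2.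
have d0 : 0 < d by rewrite divr_gt0// lt_min !subr_gt0 t1p.
have d1 : 2 * d <= p - t1.
  by rewrite mulrC divfK// ge_min lexx.
have d2 : 2 * d <= t2 - p.
  by rewrite mulrC divfK// ge_min lexx orbT.
have [c c0 cP] := Sp d d0.
(* the factor t3 ^- 2 keeps r nonnegative on [0, t3], as |x - p| <= t3 *)
pose r : {poly R} := 1 + (t3 ^- 2 *: ((d ^+ 2)%:P - ('X - p%:P) ^+ 2)).
have rE x : r.[x] = 1 + (d ^+ 2 - (x - p) ^+ 2) / t3 ^+ 2.
  by rewrite /r !hornerE mulrC.
have t30 : 0 < t3 ^+ 2 by rewrite exprn_gt0//; lra.
pose rho := 1 - 3 * d ^+ 2 / t3 ^+ 2.
have rho_ge0 : 0 <= rho.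
  by rewrite /rho subr_ge0 ler_pdivrMr// mul1r; nra.
have rho_lt1 : rho < 1.
  by rewrite /rho gtrBl divr_gt0// mulr_gt0// exprn_gt0.
have bound n : c <= a 0%N * rho ^+ n.*2.
  have r2n x : (r ^+ n.*2).[x] = (r.[x] ^+ n) ^+ 2.
    by rewrite horner_exp -exprM muln2.
  have rn0 : nonneg_on_Rplus (r ^+ n.*2).
    by move=> x _; rewrite r2n sqr_ge0.
  apply: (@le_trans _ _ (moment_functional a (r ^+ n.*2))).
    apply: cP => // x x0 xp; rewrite horner_exp exprn_ege1// rE lerDl.
    rewrite divr_ge0 ?(ltW t30)// subr_ge0 -real_normK ?num_real//.
    by rewrite ler_sqr ?nnegrE// ltW.
  have mitv (i : interval R) : measurable ([set` i] : set (measurableTypeR R)).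
    exact: measurable_itv.
  pose N : set (measurableTypeR R) := `]t1, t2[%classic `|` `]t3, +oo[%classic.
  rewrite mulrC; apply: (@moment_functional_le _ mu _ _ N) => //.
  - exact: (measurableU _ _ (mitv _) (mitv _)).
  - by rewrite /N measureU0//; exact: mitv.
  - exact: exprn_ge0.
  move=> x x0; rewrite /N /= !in_itv /= andbT => /not_orP[/negP x12 /negP].
  rewrite -leNgt => x3.
  rewrite horner_exp; apply: lerXn2r; rewrite ?nnegrE//.
    rewrite rE -[1](divff (lt0r_neq0 t30)) -mulrDl divr_ge0 ?(ltW t30)//.
    by nra.
  rewrite rE /rho lerD2l -[leRHS]mulNr ler_pM2r ?invr_gt0//.
  by move: x12; rewrite negb_and -!leNgt => /orP[]; nra.
have a0 : 0 < a 0%N.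
  by have := bound 0%N; rewrite expr0 mulr1; exact: lt_le_trans.
have : (rho ^+ 2) ^+ n @[n --> \oo] --> 0.
  by apply: cvg_expr; rewrite ger0_norm ?exprn_ge0// expr_lt1.
move=> /cvgrPdist_lt /(_ (c / a 0%N) (divr_gt0 c0 a0))[n _ /(_ n (leqnn n))].
rewrite /= sub0r normrN ger0_norm; last by rewrite !exprn_ge0.
rewrite ltr_pdivlMr// mulrC ltNge => /negP; apply.
by rewrite -exprM mul2n bound.
Qed.

End product.

(** * The maximum of the support of a root *)

Lemma geometric_domination_le0 {R : realType} {x y c C : R} :
  0 <= y -> y < x -> (forall n, c * x ^+ n <= C * y ^+ n) -> c <= 0.
Proof.
move=> y0 yx H; rewrite leNgt; apply/negP => c0.
have x0 : 0 < x by exact: le_lt_trans yx.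
have C0 : 0 < C.
  by have := H 0%N; rewrite !expr0 !mulr1; exact: lt_le_trans.
have : (y / x) ^+ n @[n --> \oo] --> 0.
  apply: cvg_expr; rewrite ger0_norm ?divr_ge0 ?(ltW x0)//.
  by rewrite ltr_pdivrMr// mul1r.
move=> /cvgrPdist_lt /(_ (c / C) (divr_gt0 c0 C0))[n _ /(_ n (leqnn n))].
rewrite /= sub0r normrN ger0_norm; last first.
  by rewrite exprn_ge0// divr_ge0// ltW.
rewrite ltr_pdivlMr// expr_div_n mulrAC ltr_pdivrMr ?exprn_gt0//.
by rewrite mulrC ltNge H.
Qed.

Section top_of_support.
Context {R : realType}.
Implicit Types (mu nu : {measure set (measurableTypeR R) -> \bar R}).
Implicit Types (a b : nat -> R).

Lemma tail_mass_le_moments {nu b} {s : R} :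
  representing_measure nu b -> 0 <= s ->
  exists r : R, [/\ nu `[s, +oo[%classic = r%:E, 0 <= r &
    forall n, r * s ^+ n <= b n].
Proof.
move=> nub s0.
have bound n : ((s ^+ n)%:E * nu `[s, +oo[%classic <= (b n)%:E)%E.
  rewrite -(moment_functionalXn b n); apply: (@le_moment_functional _ nu) => //.
  - by move=> x x0; rewrite hornerXn exprn_ge0.
  - exact: exprn_ge0.
  - move=> x x0 /=; rewrite in_itv /= andbT hornerXn => sx.
    by rewrite lerXn2r ?nnegrE.
have fin : nu `[s, +oo[%classic \is a fin_num.
  rewrite ge0_fin_numE//; apply: le_lt_trans (ltry (b 0)).
  by have := bound 0%N; rewrite expr0 mul1e.
exists (fine (nu `[s, +oo[%classic)); split.
- by rewrite fineK.
- exact: fine_ge0.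
- by move=> n; rewrite -lee_fin EFinM fineK// muleC.
Qed.

Lemma moment_le_of_support_bound {nu b} {N : set (measurableTypeR R)}
    {s : R} n :
  representing_measure nu b -> 0 <= s -> measurable N -> nu N = 0%E ->
  (forall x, 0 <= x -> ~ N x -> x <= s) -> b n <= s ^+ n * b 0%N.
Proof.
move=> nub s0 mN N0 Ns; rewrite -(moment_functionalXn b n).
apply: (moment_functional_le nub _ mN N0); first 2 last.
- by move=> x x0 Nx; rewrite hornerXn lerXn2r ?nnegrE//; exact: Ns.
- by move=> x x0; rewrite hornerXn exprn_ge0.
- exact: exprn_ge0.
Qed.

Lemma measure_above_sup_support {mu} {t : R} :
  ereal_sup [set x%:E | x in msupport mu] = t%:E ->
  mu `]t, +oo[%classic = 0%E.
Proof.
move=> tE; apply: measure0_of_disjoint_msupport; first exact: measurable_itv.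
move=> x; rewrite /= in_itv /= andbT => tx Sx.
have : (x%:E <= t%:E)%E by rewrite -tE; apply: ereal_sup_ubound; exists x.
by rewrite lee_fin leNgt tx.
Qed.

(** The growth rate of the moments is the maximum of the support.  As a n
    grows like (g ^ k) ^ n, mass of nu beyond g would make b, hence a, grow
    too fast; if moreover nu had no mass near g, then b n would be bounded by
    a multiple of h ^ n with h < g and a would grow too slowly. *)
Lemma msupport_root_of_top {mu nu a b} {k : nat} {g : R} : (0 < k)%N ->
  representing_measure mu a -> representing_measure nu b ->
  (forall n, b n ^+ k = a n) -> 0 < g ->
  ereal_sup [set x%:E | x in msupport mu] = (g ^+ k)%:E ->
  msupport nu g.
Proof.
move=> k0 mua nub bka g0 tE; apply: contrapT => /msupportN_ball[e e0 nue].
have k_neq0 : k != 0%N by rewrite -lt0n.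
have mu_top := measure_above_sup_support tE.
have a_le n : a n <= a 0%N * (g ^+ k) ^+ n.
  rewrite mulrC; apply: (moment_le_of_support_bound n mua _ _ mu_top).
  - exact/exprn_ge0/ltW.
  - exact: measurable_itv.
  - by move=> x _ /=; rewrite in_itv /= andbT => /negP; rewrite -leNgt.
have [m [nu_tail m0 mb]] := tail_mass_le_moments nub (ltW (addr_gt0 g0 e0)).
have b_ge0 n : 0 <= b n.
  by apply: le_trans (mb n); rewrite mulr_ge0// exprn_ge0// addr_ge0 ?ltW.
have m_eq0 : m = 0.
  apply/eqP; rewrite eq_le m0 andbT leNgt; apply/negP => m_gt0.
  have : m ^+ k <= 0.
    apply: (@geometric_domination_le0 _ ((g + e) ^+ k) (g ^+ k) _ (a 0%N)).
    - exact/exprn_ge0/ltW.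
    - by rewrite ltrXn2r ?nnegrE ?ltrDl// ltW// addr_gt0.
    move=> n; apply: le_trans (a_le n).
    rewrite -bka exprAC -exprMn lerXn2r ?nnegrE//.
    by rewrite mulr_ge0// exprn_ge0// addr_ge0 ?ltW.
  by rewrite leNgt exprn_gt0.
(* truncated at 0 because g - e may be negative *)
pose h := Num.max (g - e) 0.
have h0 : 0 <= h by rewrite le_max lexx orbT.
have hg : h < g by rewrite gt_max g0 andbT gtrBl.
have hgk : h ^+ k < g ^+ k by rewrite ltrXn2r ?nnegrE// ltW.
have a_le' n : a n <= b 0%N ^+ k * (h ^+ k) ^+ n.
  have mitv (i : interval R) : measurable ([set` i] : set (measurableTypeR R)).
    exact: measurable_itv.
  pose N : set (measurableTypeR R) :=
    `]g - e, g + e[%classic `|` `[g + e, +oo[%classic.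
  rewrite -bka mulrC exprAC -exprMn lerXn2r ?nnegrE ?mulr_ge0 ?exprn_ge0//.
  apply: (@moment_le_of_support_bound nu b N) => //.
  - exact: (measurableU _ _ (mitv _) (mitv _)).
  - by rewrite /N measureU0// nu_tail m_eq0.
  move=> x x0; rewrite /N /= !in_itv /= andbT => /not_orP[/negP x1 /negP x2].
  rewrite le_max; apply/orP; left.
  by move: x1 x2; rewrite negb_and -!leNgt -ltNge => /orP[//|]; lra.
pose s := (h ^+ k + g ^+ k) / 2.
have hs : h ^+ k < s by rewrite /s; lra.
have sg : s < g ^+ k by rewrite /s; lra.
have hk0 : 0 <= h ^+ k by exact: exprn_ge0.
have [_ [y Sy <-]] : exists2 z, [set x%:E | x in msupport mu] z & (s%:E < z)%E.
  by apply: ereal_sup_gt; rewrite tE lte_fin.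
rewrite lte_fin => sy.
have [r [mu_tail r0 ra]] := tail_mass_le_moments mua (le_trans hk0 (ltW hs)).
have : r <= 0.
  apply: (geometric_domination_le0 hk0 hs) => n.
  exact: le_trans (ra n) (a_le' n).
rewrite -lee_fin -mu_tail leNgt => /negP; apply.
apply: (@lt_le_trans _ _ (mu `]s, +oo[%classic)).
  by apply: Sy; [exact: interval_open | rewrite /= in_itv /= sy].
apply: le_measure; rewrite ?inE; try exact: measurable_itv.
by move=> z; rewrite /= !in_itv /= !andbT => /ltW.
Qed.

End top_of_support.

(** * Chains of products that cannot jump over the gap *)

Lemma first_crossing {R : realType} {v : nat -> R} {n : nat} {t1 t2 : R} :
  t1 < v 0%N -> v n < t2 ->
  (forall i, (i < n)%N -> t2 <= v i -> t1 < v i.+1) ->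
  exists2 i, (i <= n)%N & t1 < v i < t2.
Proof.
move=> v0; elim: n => [vn _|n IH vn step].
  by exists 0%N => //; rewrite v0.
have [vn2|vn2] := ltP (v n) t2.
  have [|i le_in iP] := IH vn2; last by exists i => //; exact: leqW.
  by move=> i lt_in; apply: step; exact: ltnW.
by exists n.+1 => //; rewrite vn step.
Qed.

(** A step of the chain multiplies by x / g.  If a term with i >= 1 factors x
    is still at least t2, then so is x * g ^ (k - 1), that is,
    x / g >= t2 / g ^ k; one step then leads to at least t2 ^ 2 / g ^ k > t1. *)
Lemma power_in_gap {R : realType} {k : nat} {x g t1 t2 : R} : (0 < k)%N ->
  0 < x -> x <= g -> t1 < x * g ^+ k.-1 -> x ^+ k < t2 ->
  t1 * g ^+ k < t2 ^+ 2 ->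
  exists i j, (i + j = k)%N /\ t1 < x ^+ i * g ^+ j < t2.
Proof.
case: k => // k _ x0 xg vlo vhi t12; rewrite /= in vlo.
have g0 : 0 < g by exact: lt_le_trans xg.
pose v i := x ^+ i.+1 * g ^+ (k - i).
have [| |i ik iv|i ik vi] := @first_crossing _ v k t1 t2; last 1 first.
- by exists i.+1, (k - i)%N; rewrite addSn subnKC.
- by rewrite /v subn0 expr1.
- by rewrite /v subnn expr0 mulr1.
have vS : v i.+1 * g = v i * x.
  by rewrite /v -(subnSK ik) !exprS; ring.
have vi_le : v i <= x * g ^+ k.
  rewrite /v exprS -mulrA ler_pM2l// -[in leRHS](subnKC (ltnW ik)) exprD.
  by rewrite ler_pM2r ?exprn_gt0// lerXn2r ?nnegrE// ltW.
have gk0 : 0 < g ^+ k by exact: exprn_gt0.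
rewrite -(ltr_pM2r g0) vS; rewrite exprS in t12.
have t20 : 0 < t2 by apply: lt_trans vhi; exact: exprn_gt0.
have : t1 * g * (g ^+ k) < v i * x * g ^+ k.
  apply: (@lt_le_trans _ _ (t2 ^+ 2)); first by rewrite -mulrA.
  by rewrite expr2 -mulrA ler_pM ?(ltW t20)//; exact: le_trans vi_le.
by rewrite ltr_pM2r.
Qed.

(** A step of the chain multiplies by b / g, and t2 * (b / g) > t1 is the last
    hypothesis after taking k-th roots. *)
Lemma mixed_power_in_gap {R : realType} {k : nat} {x b g t1 t2 : R} :
  (0 < k)%N -> 0 < x -> x < b -> b < g -> 0 < t1 -> t1 < x * g ^+ k.-1 ->
  b ^+ k = t2 -> g ^+ k * t1 ^+ k < t2 * t2 ^+ k ->
  exists i j, (i + j = k.-1)%N /\ t1 < x * (b ^+ i * g ^+ j) < t2.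
Proof.
case: k => // k _ x0 xb bg t10 vlo bk t12; rewrite /= in vlo *.
have b0 : 0 < b by exact: lt_trans xb.
have g0 : 0 < g by exact: lt_trans bg.
have t20 : 0 < t2 by rewrite -bk exprn_gt0.
have {}t12 : g * t1 < b * t2.
  rewrite -(@ltr_pXn2r _ k.+1) ?nnegrE ?mulr_ge0 ?(ltW g0) ?(ltW t10) ?(ltW b0)
    ?(ltW t20)//.
  by rewrite !exprMn bk.
pose v i := x * (b ^+ i * g ^+ (k - i)).
have [| |i ik iv|i ik vi] := @first_crossing _ v k t1 t2; last 1 first.
- by exists i, (k - i)%N; rewrite subnKC.
- by rewrite /v subn0 expr0 mul1r.
- by rewrite /v subnn expr0 mulr1 -bk exprS ltr_pM2r// exprn_gt0.
have vS : v i.+1 * g = v i * b.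
  by rewrite /v -(subnSK ik) !exprS; ring.
rewrite -(ltr_pM2r g0) vS mulrC; apply: lt_le_trans t12 _.
by rewrite mulrC ler_pM2r.
Qed.

(** * The gap indices *)

Section indices.
Context {R : realType}.

(** iota_s^* <= n means ln (t3 / t2) < n * ln (t2 / t1), the strictness coming
    from the floor; this is the exponentiated, denominator-free form. *)
Lemma iota_s_star_le {t1 t2 t3 : R} {n : nat} :
  0 < t1 -> t1 < t2 -> t2 < t3 -> iota_s_star t1 t2 t3 <= n%:Z ->
  t3 * t1 ^+ n < t2 * t2 ^+ n.
Proof.
move=> t10 t12 t23; have t20 := lt_trans t10 t12; have t30 := lt_trans t20 t23.
have r0 : 0 < ln (t2 / t1) by rewrite ln_gt0// ltr_pdivlMr// mul1r.
rewrite /iota_s_star -ltzD1 addrC ltrD2r floor_lt_int ltr_pdivrMr//.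
rewrite mulr_natl -lnXn ?divr_gt0// ltr_ln ?posrE ?exprn_gt0 ?divr_gt0//.
rewrite ltr_pdivrMr// expr_div_n mulrAC ltr_pdivlMr ?exprn_gt0//.
by rewrite [X in _ < X]mulrC.
Qed.

(** Both indices only depend on the two logarithmic gap lengths
    A = ln (t3 / t2) and D = ln (t2 / t1). *)
Lemma iota_sE {t1 t2 t3 : R} : 0 < t1 -> t1 < t2 -> t2 < t3 ->
  exists A D : R, [/\ 0 < A, 0 < D,
    iota_s t1 t2 t3 = 1 + Num.floor ((A + D) / A) &
    iota_s_star t1 t2 t3 = 1 + Num.floor (A / D)].
Proof.
move=> t10 t12 t23; have t20 := lt_trans t10 t12; have t30 := lt_trans t20 t23.
exists (ln (t3 / t2)), (ln (t2 / t1)); split => //.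
- by rewrite ln_gt0// ltr_pdivlMr// mul1r.
- by rewrite ln_gt0// ltr_pdivlMr// mul1r.
by rewrite -lnM ?posrE ?divr_gt0// mulrA divfK// gt_eqF.
Qed.

(** With A and D as above, if A >= 2 * D then (A + D) / A <= 3 / 2, so
    iota_s <= 2 while iota_s^* >= 3, which contradicts both alternatives. *)
Lemma iota_s_star_le2 {t1 t2 t3 : R} : 0 < t1 -> t1 < t2 -> t2 < t3 ->
  3 <= iota_s t1 t2 t3 \/ iota_s_star t1 t2 t3 <= iota_s t1 t2 t3 ->
  iota_s_star t1 t2 t3 <= 2.
Proof.
move=> t10 t12 t23; have [A [D [A0 D0 -> ->]]] := iota_sE t10 t12 t23 => H.
suff : Num.floor (A / D) < 2 by lia.
rewrite floor_lt_int ltr_pdivrMr// ltNge; apply/negP => AD.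
have fs : Num.floor ((A + D) / A) < 2.
  by rewrite floor_lt_int ltr_pdivrMr//; lra.
have fss : 2 <= Num.floor (A / D) by rewrite floor_ge_int ler_pdivlMr.
by case: H; lia.
Qed.

Lemma iota_s_star_le1 {t1 t2 t3 : R} : 0 < t1 -> t1 < t2 -> t2 < t3 ->
  4 <= iota_s t1 t2 t3 -> iota_s_star t1 t2 t3 <= 1.
Proof.
move=> t10 t12 t23; have [A [D [A0 D0 -> ->]]] := iota_sE t10 t12 t23.
move=> H; have : 3 <= Num.floor ((A + D) / A) by lia.
rewrite floor_ge_int ler_pdivlMr// => AD.
rewrite gerDl floor_le0 ltr_pdivrMr//; lra.
Qed.

End indices.

(** * The gap in the support of the root *)

Lemma krootK {R : realType} {k : nat} {x : R} :
  (0 < k)%N -> 0 <= x -> kroot k x ^+ k = x.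
Proof.
move=> k0 x0; rewrite /kroot -powR_mulrn ?powR_ge0// -powRrM mulVf ?powRr1//.
by rewrite pnatr_eq0 -lt0n.
Qed.

Theorem theorem6p3 (R : realType) (k : nat) (a : nat -> R)
    (mu nu : {measure set (measurableTypeR R) -> \bar R})
    (theta1 theta2 theta3 : R)
    (k_ge2 : (2 <= k)%N)
    (a_stieltjes : stieltjes_moment_seq a)
    (mu_repr : representing_measure mu a)
    (root_a_stieltjes : stieltjes_moment_seq (fun n => kroot k (a n)))
    (nu_repr : representing_measure nu (fun n => kroot k (a n)))
    (theta1_gt0 : 0 < theta1) (theta12 : theta1 < theta2)
    (theta23 : theta2 < theta3)
    (theta3E : ereal_sup [set x%:E | x in msupport mu] = theta3%:E)
    (mu_gap : mu `]theta1, theta2[%classic = 0%E) :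
  let alpha := theta1 / theta3 * kroot k theta3 in
  let beta := kroot k theta2 in
  let ios := iota_s theta1 theta2 theta3 in
  let ios_star := iota_s_star theta1 theta2 theta3 in
  (ios_star <= k%:Z /\ msupport nu beta) \/
  (ios_star <= ios /\ msupport nu beta) \/
  (3 <= ios /\ msupport nu beta) \/
  4 <= ios \/
  ios_star = 1 ->
  nu `]alpha, beta[%classic = 0%E.
Proof.
move=> alpha beta ios ios_star cond.
have k0 : (0 < k)%N by exact: ltnW.
have t20 := lt_trans theta1_gt0 theta12; have t30 := lt_trans t20 theta23.
pose g := kroot k theta3; pose b n := kroot k (a n).
have gk : g ^+ k = theta3 by exact/krootK/ltW.
have betak : beta ^+ k = theta2 by exact/krootK/ltW.
have g0 : 0 < g by exact: powR_gt0.
have beta0 : 0 < beta by exact: powR_gt0.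
have bk n : b n ^+ k = a n by apply: krootK => //; exact: a_stieltjes.1.
have beta_g : beta < g.
  by rewrite -(@ltr_pXn2r _ k) ?nnegrE ?ltW// betak gk.
have Sg : msupport nu g.
  by apply: (msupport_root_of_top k0 mu_repr nu_repr bk g0); rewrite gk.
have gap p : functional_support (fun n => b n ^+ k) p -> ~ theta1 < p < theta2.
  rewrite (_ : (fun n => b n ^+ k) = a); last exact/funext.
  apply: (functional_support_avoids_gap mu_repr theta1_gt0 theta23 mu_gap).
  exact: measure_above_sup_support.
(* the five conditions reduce to two *)
have {cond}: (ios_star <= k%:Z /\ msupport nu beta) \/ ios_star <= 1.
  have le2 H := le_trans (iota_s_star_le2 theta1_gt0 theta12 theta23 H)
    (k_ge2 : 2 <= k%:Z).
  case: cond => [|[[H Sb]|[[H Sb]|[H|->]]]]; first by left.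
  - by left; split=> //; apply: le2; right.
  - by left; split=> //; apply: le2; left.
  - by right; exact: iota_s_star_le1 H.
  - by right.
move=> cond; apply: measure0_of_disjoint_msupport; first exact: measurable_itv.
move=> x; rewrite /= in_itv /= => /andP[alpha_x x_beta] Sx.
have x0 : 0 < x.
  by apply: lt_trans alpha_x; rewrite mulr_gt0// divr_gt0.
have x_lo : theta1 < x * g ^+ k.-1.
  have -> : theta1 = alpha * g ^+ k.-1.
    by rewrite -mulrA -exprS prednK// gk divfK// gt_eqF.
  by rewrite ltr_pM2r// exprn_gt0.
have [[ios_k Sb]|ios1] := cond.
  have t123 := iota_s_star_le theta1_gt0 theta12 theta23 ios_k.
  rewrite -{1}gk in t123.
  have [i [j [ijk]]] := mixed_power_in_gap k0 x0 x_beta beta_g theta1_gt0 x_lo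
    betak t123.
  apply: gap; rewrite (_ : (fun n => b n ^+ k) = fun n => b n * b n ^+ (i + j)).
    exact: functional_supportM nu_repr (positive_functionalX _ nu_repr) Sx
      (functional_supportX nu_repr Sb Sg).
  by apply/funext => n; rewrite ijk -exprS prednK.
have t123 := iota_s_star_le (n := 1) theta1_gt0 theta12 theta23 ios1.
rewrite !expr1 mulrC -gk -expr2 in t123.
have xk : x ^+ k < theta2 by rewrite -betak ltrXn2r ?nnegrE ?ltW// -lt0n.
have [i [j [ijk]]] :=
  power_in_gap k0 x0 (ltW (lt_trans x_beta beta_g)) x_lo xk t123.
by apply: gap; rewrite -ijk; exact: functional_supportX nu_repr Sx Sg.
Qed.
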